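(* For all $k \in \mathbb{N}$ we have $\mathrm{minvdeg}(\mathcal{MU}_{\delta=k}) \le \mathrm{N}_1(k)$, where $\mathrm{N}_1 = \mathrm{nM}([2,4,5,6,8,8])$ and $[2,4,5,6,8,8]$ denotes the function $f : \mathbb{N} \to \mathbb{N} \cup \{+\infty\}$ with $(f(1),\dots,f(6)) = (2,4,5,6,8,8)$ and $f(k) = +\infty$ for $k \ge 7$.
   Context: Literals come with a fixed-point-free involution $x \mapsto \overline{x}$; variables are positive literals. A clause is a finite set $C$ of literals with $C \cap \overline{C} = \emptyset$; a clause-set is a finite set of clauses; $\delta(F) = |F| - |\mathrm{var}(F)|$. $\mathcal{MU}_{\delta=k}$ is the class of minimally unsatisfiable clause-sets (unsatisfiable, satisfiable after removing any clause) with $\delta = k$. $\mathrm{vdeg}_F(v)$ is the number of clauses of $F$ containing $v$ or $\overline{v}$; $\mathrm{minvdeg}(F) = \min_{v \in \mathrm{var}(F)} \mathrm{vdeg}_F(v)$; for a class $\mathcal{D}$, $\mathrm{minvdeg}(\mathcal{D})$ is the supremum of $\mathrm{minvdeg}(F)$ over $F \in \mathcal{D}$ with $\mathrm{var}(F) \ne \emptyset$. For $g : \mathbb{N} \to \mathbb{N} \cup \{+\infty\}$ and $k \ge 2$, $m \ge 4$, $\mathrm{pdp}_g(k,m)$ is the set of pairs $(e_0,e_1) \in \mathbb{N}^2$ with (i) $e_0, e_1 \ge 2$; (ii) $e_0,e_1 \le k$; (iii) $e_0+e_1 = m$; (iv) $e_0 \le e_1$; (v) $g(k-e_\varepsilon+1)+e_\varepsilon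 \ge m$ for both $\varepsilon \in \{0,1\}$. For $f$ with $f(1) = 2$, $f' = \mathrm{nM}(f)$ is defined by $f'(1) = 2$ and, for $k > 1$, $f'(k) = \min(m, f(k))$ where $m$ is the largest integer in $\{4,\dots,2k\}$ with $\mathrm{pdp}_{f'}(k,m) \ne \emptyset$ (this uses only $f'(k')$ for $k' < k$). *)

(* Defs.v *)
From HB Require Import structures.
From mathcomp Require Import all_boot all_order all_algebra.
From mathcomp Require Import finmap.
Set Implicit Arguments. Unset Strict Implicit. Unset Printing Implicit Defensive.
Local Open Scope fset_scope.

(* Literals: a variable (nat) with a polarity; (v, true) is the positive literal v,
   the involution flips the polarity (fixed-point free). *)
Definition lit := (nat * bool)%type.
Definition compl (x : lit) : lit := (x.1, ~~ x.2).
Definition clause := {fset lit}.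
Definition clauseset := {fset clause}.

Definition is_clause (C : clause) : Prop := forall x, x \in C -> compl x \notin C.
Definition is_clauseset (F : clauseset) : Prop := forall C, C \in F -> is_clause C.

Definition var_cl (C : clause) : {fset nat} := [fset x.1 | x in C].
Definition var (F : clauseset) : {fset nat} := \bigcup_(C <- F) var_cl C.

Definition delta (F : clauseset) : int := (#|` F |%:Z - #|` var F |%:Z)%R.

(* satisfied by a total assignment (equivalent to partial ones for satisfiability) *)
Definition satisfiable (F : clauseset) : Prop :=
  exists phi : nat -> bool, forall C, C \in F -> exists2 x, x \in C & phi x.1 = x.2.

Definition MU (F : clauseset) : Prop :=
  ~ satisfiable F /\ forall C, C \in F -> satisfiable (F `\ C).

Definition vdeg (F : clauseset) (v : nat) : nat :=
  count (fun C : clause => ((v, true) \in C) || ((v, false) \in C)) F.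

(* minimum of vdeg over var F (only meaningful when var F is nonempty) *)
Definition minvdeg (F : clauseset) : nat :=
  let s := [seq vdeg F v | v <- var F] in foldr minn (head 0%N s) s.

(* N ∪ {+oo}: None = +oo *)
Definition extnat := option nat.
Definition ext_min (a b : extnat) : extnat :=
  match a, b with None, _ => b | _, None => a | Some x, Some y => Some (minn x y) end.
Definition ext_leq (x : nat) (a : extnat) : bool :=
  match a with None => true | Some y => (x <= y)%N end.
Definition cond_v (g : nat -> extnat) (k e m : nat) : bool :=
  ext_leq m (match g (k - e + 1)%N with None => None | Some y => Some (y + e)%N end).

Definition pdp_nonempty (g : nat -> extnat) (k m : nat) : bool :=
  has (fun e0 => let e1 := (m - e0)%N in
        [&& (2 <= e0)%N, (2 <= e1)%N, (e0 <= k)%N, (e1 <= k)%N, (e0 + e1 == m)%N,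
            (e0 <= e1)%N, cond_v g k e0 m & cond_v g k e1 m])
      (iota 0 m.+1).

(* largest m in {4,...,2k} with pdp_g(k,m) nonempty (0 if none; this case does not
   arise for the functions considered) *)
Definition largest_m (g : nat -> extnat) (k : nat) : nat :=
  foldr maxn 0%N [seq m <- iota 4 (2 * k - 3) | pdp_nonempty g k m].

Definition nM_step (f g : nat -> extnat) (k : nat) : extnat :=
  if k == 1%N then Some 2%N else ext_min (Some (largest_m g k)) (f k).

(* nM_vals f n = [:: f'(0); f'(1); ...; f'(n)] with f' = nM(f)
   (the value at 0 is an unused placeholder +oo); f'(k) only uses f'(k') for k' < k. *)
Fixpoint nM_vals (f : nat -> extnat) (n : nat) : seq extnat :=
  match n with
  | 0 => [:: None]
  | n'.+1 => let s := nM_vals f n' in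
             rcons s (nM_step f (fun j => nth None s j) n'.+1)
  end.

Definition nM (f : nat -> extnat) (k : nat) : extnat := nth None (nM_vals f k) k.

Definition f_246588 (k : nat) : extnat :=
  match k with
  | 1 => Some 2 | 2 => Some 4 | 3 => Some 5 | 4 => Some 6 | 5 => Some 8 | 6 => Some 8
  | _ => None
  end%N.

Definition N1 : nat -> extnat := nM f_246588.

(* Main.v *)
Require Import Defs.
From mathcomp Require Import all_boot all_order all_algebra.
From mathcomp Require Import finmap.
From mathcomp Require Import zify.
Local Open Scope fset_scope.

(* After saturation, assigning a value to a variable v of minimum degree yields again a minimally
   unsatisfiable clause-set; its deficiency is k - e + 1, where e is the number of satisfied clauses.
   A variable of small degree there has at most e further occurrences, and this gives the recursion
   defining nM.

   Only the value 8 at k = 6 requires more. If all degrees are at least 9, a variable v of minimum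
   degree has 5 occurrences of one sign and 4 of the other, and satisfying the 5 clauses yields
   deficiency 2 with all degrees at least 4. There are no unit clauses in it, and this forces all
   degrees to be 4; so the 5 satisfied clauses contain all variables. As every variable now has
   degree 9, the same holds for each of them, and so many full clauses cannot exist. *)

(** * Clause-sets as incidence matrices *)

(* Clause [i] contains the variable [v] with sign [b] iff [c i v = Some b]. Subinstances are given by
   a set [A] of clauses and a set [W] of variables, the entries outside [W] being ignored. *)
Section Incidence.
Local Open Scope nat_scope.
Set Implicit Arguments.
Unset Strict Implicit.
Variables T V : finType.
Implicit Types (c : T -> V -> option bool) (A : {set T}) (W : {set V}).
Implicit Types (phi : {ffun V -> bool}) (b : bool).

Definition satc c W phi i := [exists w in W, c i w == Some (phi w)].

Definition sat c A W :=
  [exists phi : {ffun V -> bool}, [forall i in A, satc c W phi i]].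

Definition critical c A W i phi :=
  forall j, j \in A -> j != i -> satc c W phi j.

(* Occurrence of every [w] in [W] is part of [mu], so that [#|A| - #|W|] is the deficiency. *)
Definition mu c A W :=
  [/\ ~~ sat c A W,
      forall i, i \in A -> exists phi, critical c A W i phi &
      forall w, w \in W -> exists2 i, i \in A & c i w != None].

(* Saturation: adding the literal [(w, ~~ b)] to clause [i] would allow the model [phi]. *)
Definition smu c A W :=
  mu c A W /\ forall i w b, i \in A -> w \in W -> c i w = None ->
    exists2 phi, critical c A W i phi & phi w = b.

Definition occs c A w b := [set i in A | c i w == Some b].
(* Assigning [b] to [w] leaves the clauses [res c A w b] over [W :\ w], with the same matrix [c]. *)
Definition res c A w b := [set i in A | c i w != Some b].
Definition deg c A w := #|[set i in A | c i w != None]|.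
Definition subc c c' := forall i w b, c i w = Some b -> c' i w = Some b.

Lemma satcP c W phi i :
  reflect (exists2 w, w \in W & c i w = Some (phi w)) (satc c W phi i).
Proof.
apply: (iffP existsP) => [[w /andP[wW /eqP e]]|[w wW e]]; exists w => //.
by rewrite wW e eqxx.
Qed.

Lemma unsatP c A W phi : ~~ sat c A W ->
  exists2 i, i \in A & forall w, w \in W -> c i w <> Some (phi w).
Proof.
move=> us; have : ~~ [forall i in A, satc c W phi i].
  by apply: contra us => h; apply/existsP; exists phi.
rewrite negb_forall => /existsP[i]; rewrite negb_imply => /andP[iA /satcP n].
by exists i => // w wW e; apply: n; exists w.
Qed.

(** A critical assignment satisfying [i] as well would be a model of all of [A]. *)
Lemma critical_falsifies c A W i phi w : ~~ sat c A W -> critical c A W i phi ->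
  w \in W -> c i w <> Some (phi w).
Proof.
move=> us cr wW e; have [j jA n] := unsatP phi us.
have [ji|ji] := eqVneq j i; first by apply: (n w wW); rewrite ji.
by have /satcP[u uW /(n u uW)] := cr j jA ji.
Qed.

Definition upd phi v b : {ffun V -> bool} :=
  [ffun w => if w == v then b else phi w].

(** If only the sign [~~ b] occurred at [w], a critical assignment for a clause containing [w] could
    be changed to [~~ b] there: this satisfies that clause and spoils no other. *)
Lemma mu_both c A W w b : mu c A W -> w \in W -> exists2 i, i \in A & c i w = Some b.
Proof.
case=> us cr oc wW; case: (pickP [pred i in A | c i w == Some b]) => [i /andP[iA /eqP e]|n].
  by exists i.
have [i iA] := oc w wW.
have e : forall j, j \in A -> c j w != None -> c j w = Some (~~ b).
  move=> j jA; have := n j; rewrite /= jA /=.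
  by case: (c j w) => [[]|] //; case: (b).
move=> /(e i iA) ei; have [phi crp] := cr i iA.
have [j jA nj] := unsatP (upd phi w (~~ b)) us.
have [ji|ji] := eqVneq j i; first by case: (nj w wW); rewrite ji ei ffunE eqxx.
have /satcP[u uW eu] := crp j jA ji; case: (nj u uW); rewrite ffunE.
by case: eqP eu => [->|] // eu; rewrite e // eu.
Qed.

Lemma card_occs_res c A w b : #|occs c A w b| + #|res c A w b| = #|A|.
Proof.
rewrite -(cardsID [set i | c i w == Some b] A); congr (_ + _); apply: eq_card => i; rewrite !inE //.
by rewrite andbC.
Qed.

Lemma degE c A w : deg c A w = #|occs c A w true| + #|occs c A w false|.
Proof.
rewrite /deg -(cardsID [set i | c i w == Some true]); congr (_ + _).
  by apply: eq_card => i; rewrite !inE; case: (c i w) => [[]|] //=; rewrite ?andbF ?andbT.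
by apply: eq_card => i; rewrite !inE; case: (c i w) => [[]|] //=; rewrite ?andbF ?andbT.
Qed.

Lemma degEb c A w b : deg c A w = #|occs c A w b| + #|occs c A w (~~ b)|.
Proof. by rewrite degE; case: b => //; rewrite addnC. Qed.

Lemma deg_res c A v b w :
  deg c A w = #|[set i in occs c A v b | c i w != None]| + deg c (res c A v b) w.
Proof.
rewrite /deg -(cardsID (occs c A v b) [set i in A | _]); congr (_ + _);
  apply: eq_card => i; rewrite !inE; case: (i \in A) => //=.
by rewrite andbC.
Qed.

Lemma deg_res_le c A v b w : deg c A w <= deg c (res c A v b) w + #|occs c A v b|.
Proof.
rewrite (deg_res c A v b) addnC leq_add2l; apply: subset_leq_card.
by apply/subsetP => i; rewrite !inE => /andP[].
Qed.

Lemma deg_le_card c A w : deg c A w <= #|A|.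
Proof. by apply: subset_leq_card; apply/subsetP => i; rewrite !inE => /andP[]. Qed.

(** * Saturation *)

Lemma subc_deg c c' A w : subc c c' -> deg c A w <= deg c' A w.
Proof.
move=> s; apply: subset_leq_card; apply/subsetP => i; rewrite !inE => /andP[-> /=].
by case e: (c i w) => [b|] // _; rewrite (s _ _ _ e).
Qed.

Lemma subc_satc c c' W phi i : subc c c' -> satc c W phi i -> satc c' W phi i.
Proof. by move=> s /satcP[w wW /s e]; apply/satcP; exists w. Qed.

(** Literals are added as long as unsatisfiability survives, which decreases the number of [None]
    entries. When the next literal would create a model, that model is the critical assignment
    demanded by [smu]. *)
Lemma saturate c A W : mu c A W -> exists2 c', subc c c' & smu c' A W.
Proof.
have [n] := ubnP #|[set p : T * V | c p.1 p.2 == None]|.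
elim: n c => // n IH c lt m; have [us cr oc] := m.
pose ext i w b : T -> V -> option bool :=
  fun j u => if (j == i) && (u == w) then Some b else c j u.
case: (pickP [pred p : T * V * bool |
   [&& p.1.1 \in A, p.1.2 \in W, c p.1.1 p.1.2 == None
    & ~~ sat (ext p.1.1 p.1.2 p.2) A W]]) => [[[i w] b]|none]; last first.
  exists c => //; split => // i w b iA wW ci.
  have := none (i, w, b); rewrite /= iA wW ci eqxx /= => /negbFE /existsP[phi /forallP h].
  have cp : critical c A W i phi.
    move=> j jA ji; move: (h j); rewrite jA /= => /satcP[u uW].
    by rewrite /ext (negbTE ji) /= => e; apply/satcP; exists u.
  exists phi => //; move: (h i); rewrite iA /= => /satcP[u uW]; rewrite /ext eqxx /=.
  case: eqP => [-> [->] //|_ e].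
  by case: (critical_falsifies us cp uW).
move=> /and4P[/= iA wW /eqP ci us'].
have s : subc c (ext i w b).
  by move=> j u b' e; rewrite /ext; case: eqP => [ji|] //=; case: eqP => [uw|] //; rewrite ji uw ci in e.
have [||c' s' sm] := IH (ext i w b).
- rewrite ltnS in lt; apply: leq_trans lt; apply: proper_card; apply/properP; split.
    apply/subsetP => -[j u]; rewrite !inE /=; case e: (c j u) => [b'|] //.
    by rewrite (s _ _ _ e).
  by exists (i, w); rewrite !inE /= ?ci // /ext !eqxx.
- split => // [j jA|u uW].
    have [phi h] := cr j jA; exists phi => l lA lj; apply: subc_satc s _; exact: h.
  have [j jA e] := oc u uW; exists j => //.
  by case e': (c j u) e => [b'|] // _; rewrite (s _ _ _ e').
by exists c' => // j u b' /s /s'.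
Qed.

(** * Splitting at a variable of minimum degree *)

Definition minvar c A W v :=
  v \in W /\ forall w, w \in W -> deg c A v <= deg c A w.

Lemma saturate_minvar c A W : mu c A W -> W != set0 ->
  exists c' v, [/\ subc c c', smu c' A W & minvar c' A W v].
Proof.
move=> m /set0Pn[w wW]; have [c' s sm] := saturate m.
case: (arg_minnP (deg c' A) wW) => v vW le.
by exists c', v; split.
Qed.

(** A surviving clause needs a critical assignment with value [b] at [v]. If the clause contains
    [v], every critical assignment has this value, as it falsifies the clause; otherwise saturation
    supplies one. The degree bound keeps every other variable occurring. *)
Lemma smu_split c A W v b : smu c A W -> v \in W ->
  (forall w, w \in W -> w != v -> #|occs c A v b| < deg c A w) ->
  mu c (res c A v b) (W :\ v).
Proof.
move=> [[us cr oc] st] vW lt; split.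
- apply/negP => /existsP[phi /forallP h].
  have [i iA n] := unsatP (upd phi v b) us.
  have ir : i \in res c A v b.
    by rewrite inE iA; apply/eqP => e; case: (n v vW); rewrite ffunE eqxx.
  move: (h i); rewrite ir /= => /satcP[w]; rewrite !inE => /andP[wv wW] e.
  by case: (n w wW); rewrite ffunE (negbTE wv).
- move=> i; rewrite inE => /andP[iA iv].
  have [phi cp pv] : exists2 phi, critical c A W i phi & phi v = b.
    case e: (c i v) iv => [b'|] iv; last exact: st.
    have [phi cp] := cr i iA; exists phi => //.
    have := critical_falsifies us cp vW; rewrite e.
    by case: (phi v) (b') (b) iv => [] [] [].
  exists phi => j; rewrite inE => /andP[jA jv] ji.
  have /satcP[w wW e] := cp j jA ji; apply/satcP; exists w => //.
  by rewrite !inE wW andbT; apply/eqP => wv; case/eqP: jv; rewrite -wv e wv pv.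
- move=> w; rewrite !inE => /andP[wv wW]; have := lt w wW wv.
  rewrite (deg_res c A v b) => l.
  have : 0 < deg c (res c A v b) w.
    rewrite lt0n; apply: contraTneq l => ->; rewrite addn0 -leqNgt; apply: subset_leq_card.
    by apply/subsetP => i; rewrite !inE => /andP[].
  by move=> /card_gt0P[i]; rewrite [in X in X -> _]inE => /andP[ir ci]; exists i.
Qed.

Lemma occs_gt0 c A W w b : mu c A W -> w \in W -> 0 < #|occs c A w b|.
Proof.
move=> m wW; have [i iA e] := mu_both b m wW.
by apply/card_gt0P; exists i; rewrite inE iA e eqxx.
Qed.

(* Minimality of the degree guarantees that no variable vanishes together with the satisfied clauses. *)
Lemma minvar_split c A W v b : smu c A W -> minvar c A W v -> mu c (res c A v b) (W :\ v).
Proof.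
move=> sm [vW le]; apply: smu_split => // w wW _; apply: leq_trans (le w wW).
have := occs_gt0 (~~ b) sm.1 vW.
rewrite (degEb c A v b); lia.
Qed.

Lemma mu_gt0 c A W : mu c A W -> 0 < #|A|.
Proof. by case=> us _ _; have [i iA _] := unsatP [ffun _ => true] us; apply/card_gt0P; exists i. Qed.

(* Tarsi's lemma. *)
Lemma mu_card c A W : mu c A W -> #|W| < #|A|.
Proof.
have [n] := ubnP #|W|; elim: n c A W => // n IH c A W lt m.
have [->|W0] := eqVneq W set0; first by rewrite cards0 (mu_gt0 m).
have [c' [v [s sm mv]]] := saturate_minvar m W0.
have := minvar_split true sm mv; have vW := mv.1.
have cW := cardsD1 v W; rewrite vW in cW.
move=> /IH h; have := h ltac:(lia).
have := card_occs_res c' A v true; have := occs_gt0 true sm.1 vW; lia.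
Qed.

(** Tarsi's lemma makes the deficiency after the split positive, which bounds the number of
    satisfied clauses by [k]. *)
Lemma minvar_occs c A W v b k : smu c A W -> minvar c A W v -> #|A| = #|W| + k ->
  [/\ 0 < #|occs c A v b|, #|occs c A v b| <= k &
      #|res c A v b| = #|W :\ v| + (k - #|occs c A v b| + 1)].
Proof.
move=> sm mv cA; have := mu_card (minvar_split b sm mv); have vW := mv.1.
have cW := cardsD1 v W; rewrite vW in cW.
have := card_occs_res c A v b; have := occs_gt0 b sm.1 vW.
by split; lia.
Qed.

(** An empty clause is unsatisfiable by itself, so minimality excludes any other clause. *)
Lemma mu_empty c A W i : mu c A W -> i \in A -> (forall w, w \in W -> c i w = None) -> A = [set i].
Proof.
move=> [us cr _] iA n; apply/setP => j; rewrite inE; apply/idP/eqP => [jA|->//].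
apply/eqP; apply/negPn/negP => ji.
have [phi cp] := cr j jA; have /satcP[w wW] : satc c W phi i by apply: cp => //; rewrite eq_sym.
by rewrite n.
Qed.

Lemma mu_card1 c A W : mu c A W -> W = set0 -> #|A| = 1.
Proof.
move=> m W0; have /card_gt0P[i iA] := mu_gt0 m.
by rewrite (mu_empty m iA) ?cards1 // => w; rewrite W0 inE.
Qed.

(** With a single variable both splits leave one clause, so each sign occurs in [#|A| - 1] clauses;
    as the degree is at most [#|A|], there are at most two clauses. *)
Lemma mu_vars_gt1 c A W k : mu c A W -> #|A| = #|W| + k -> 1 < k -> 1 < #|W|.
Proof.
move=> m cA k1; rewrite ltnNge; apply/negP => W1.
have [W0|W0] := eqVneq W set0; first by have := mu_card1 m W0; rewrite cA W0 cards0; lia.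
have [c' [v [s sm mv]]] := saturate_minvar m W0.
have cW := cardsD1 v W; rewrite mv.1 in cW.
have W'0 : W :\ v = set0 by apply: cards0_eq; lia.
have r0 := mu_card1 (minvar_split true sm mv) W'0.
have r1 := mu_card1 (minvar_split false sm mv) W'0.
have := card_occs_res c' A v true; have := card_occs_res c' A v false.
have := deg_le_card c' A v; rewrite degE; lia.
Qed.

(** In a saturation each sign occurs at most once at a variable of minimum degree, and saturation
    only increases degrees. *)
Lemma mu1_deg_le2 c A W : mu c A W -> #|A| = #|W| + 1 -> W != set0 ->
  exists2 w, w \in W & deg c A w <= 2.
Proof.
move=> m cA W0; have [c' [v [s sm mv]]] := saturate_minvar m W0.
exists v; first exact: mv.1.
apply: leq_trans (subc_deg A v s) _; rewrite degE.
have [_ + _] := minvar_occs true sm mv cA; have [_ + _] := minvar_occs false sm mv cA; lia.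
Qed.

(** * Small deficiencies *)

Lemma mu2_deg_le4 c A W : mu c A W -> #|A| = #|W| + 2 ->
  exists2 w, w \in W & deg c A w <= 4.
Proof.
move=> m cA; have W0 : W != set0 by rewrite -card_gt0 (ltn_trans _ (mu_vars_gt1 m cA _)).
have [c' [v [s sm mv]]] := saturate_minvar m W0.
exists v; first exact: mv.1.
apply: leq_trans (subc_deg A v s) _; rewrite degE.
have [_ + _] := minvar_occs true sm mv cA; have [_ + _] := minvar_occs false sm mv cA; lia.
Qed.

Lemma setD1_neq0 W v : v \in W -> 1 < #|W| -> W :\ v != set0.
Proof. by move=> vW; rewrite (cardsD1 v) vW -card_gt0. Qed.

Lemma deg_le2_pair c A w P Q : deg c A w <= 2 -> P \in A -> Q \in A -> P != Q ->
  c P w != None -> c Q w != None -> forall j, j \in A -> c j w != None -> j = P \/ j = Q.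
Proof.
move=> d PA QA PQ cP cQ j jA cj.
have : [set P; Q] == [set i in A | c i w != None].
  rewrite eqEcard cards2 PQ d andbT; apply/subsetP => i.
  by rewrite !inE => /orP[]/eqP->; rewrite ?PA ?QA.
by move=> /eqP/setP/(_ j); rewrite !inE jA cj => /orP[]/eqP; [left|right].
Qed.

(* Otherwise the model separating [Q] from the rest could be flipped at [v]. *)
Lemma smu_rows_eq c A W v b P Q : smu c A W -> v \in W -> P \in A -> Q \in A ->
  c P v = Some b -> c Q v = Some (~~ b) ->
  (forall j, j \in A -> c j v != None -> j = P \/ j = Q) ->
  forall w b', w \in W -> w != v -> c P w = Some b' -> c Q w = Some b'.
Proof.
move=> [[us cr oc] st] vW PA QA Pv Qv only w b' wW wv Pw.
apply/eqP; apply/negPn/negP => /eqP Qw.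
have [phi cp pw] : exists2 phi, critical c A W Q phi & phi w = b'.
  case e: (c Q w) Qw => [b''|] Qw; last exact: st.
  have [phi cp] := cr Q QA; exists phi => //.
  have := critical_falsifies us cp wW; rewrite e.
  by case: (phi w) (b') (b'') Qw => [] [] [].
have [i iA n] := unsatP (upd phi v (~~ b)) us.
have iQ : i != Q by apply/eqP => iQ; case: (n v vW); rewrite iQ ffunE eqxx.
have iP : i != P by apply/eqP => iP; case: (n w wW); rewrite iP ffunE (negbTE wv) pw.
have iv : c i v = None.
  by case e: (c i v) => [x|] //; case: (only i iA); rewrite ?e //; move/eqP; rewrite ?(negbTE iQ) ?(negbTE iP).
have /satcP[u uW eu] := cp i iA iQ; case: (n u uW); rewrite ffunE.
by case: eqP eu => [->|] //; rewrite iv.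
Qed.

(** * Clashes and unit clauses in deficiency 1 *)

Lemma mu1_minvar c A W v : smu c A W -> minvar c A W v -> #|A| = #|W| + 1 ->
  [/\ deg c A v <= 2 & forall b, #|res c A v b| = #|W :\ v| + 1].
Proof.
move=> sm mv cA; have [a1 a2 a3] := minvar_occs true sm mv cA.
have [b1 b2 b3] := minvar_occs false sm mv cA.
by split; [rewrite degE; lia|case; lia].
Qed.

(** Two clauses clashing at the variable [v] of minimum degree are its only occurrences, so after
    saturation they agree elsewhere. If they do not clash at [v], some value of [v] satisfies
    neither, both survive the split, and induction applies. *)
Lemma mu1_clash c A W i j u u' b b' : mu c A W -> #|A| = #|W| + 1 ->
  i \in A -> j \in A -> u \in W -> u' \in W ->
  c i u = Some b -> c j u = Some (~~ b) ->
  c i u' = Some b' -> c j u' = Some (~~ b') -> u = u'.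
Proof.
have [n] := ubnP #|W|; elim: n c A W => // n IH c A W lt m cA iA jA uW u'W iu ju iu' ju'.
have W0 : W != set0 by apply/set0Pn; exists u.
have [c' [v [s sm mv]]] := saturate_minvar m W0.
have [d r] := mu1_minvar sm mv cA; have vW := mv.1.
have cW := cardsD1 v W; rewrite vW in cW.
move: iu ju iu' ju' => /s iu /s ju /s iu' /s ju'.
have ij : i != j by apply/eqP => ij; move: iu ju; rewrite ij => ->; case: (b).
have [[x [xi xj]]|[b0 [bi bj]]] : (exists x, c' i v = Some x /\ c' j v = Some (~~ x)) \/
    (exists b0, c' i v != Some b0 /\ c' j v != Some b0).
- case: (c' i v) (c' j v) => [[]|] [[]|];
    by [left; exists true|left; exists false|right; exists true|right; exists false].
- have only := deg_le2_pair d iA jA ij.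
  rewrite xi xj in only; have {}only := only isT isT.
  have eq w y : w \in W -> c' i w = Some y -> c' j w = Some (~~ y) -> w = v.
    move=> wW iw jw; apply/eqP/negPn/negP => wv.
    by have := smu_rows_eq sm vW iA jA xi xj only wW wv iw; rewrite jw; case: (y).
  by rewrite (eq u b) // (eq u' b').
have uv w y : c' i w = Some y -> c' j w = Some (~~ y) -> w != v.
  by move=> iw jw; apply: contraNneq bi => wv; move: bj; rewrite -wv iw jw; case: y b0 {iw jw} => [] [].
apply: (IH c' (res c' A v b0) (W :\ v) _ (minvar_split b0 sm mv) (r b0) _ _ _ _ iu ju iu' ju').
- lia.
- by rewrite inE iA.
- by rewrite inE jA.
- by rewrite !inE uW (uv _ _ iu ju).
- by rewrite !inE u'W (uv _ _ iu' ju').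
Qed.

Definition unit_in c A W := exists i x, [/\ i \in A & forall w, w \in W -> w != x -> c i w = None].

(** A critical assignment for another clause with this literal would satisfy the unit clause, hence
    the literal, hence the clause that it must falsify. *)
Lemma unit_occs c A W i x b : mu c A W -> i \in A -> x \in W -> c i x = Some b ->
  (forall w, w \in W -> w != x -> c i w = None) -> occs c A x b = [set i].
Proof.
move=> [us cr _] iA xW ix iu.
apply/setP => j; rewrite [LHS]inE [RHS]inE; apply/andP/eqP => [[jA /eqP jx]|->]; last first.
  by rewrite iA ix eqxx.
apply/eqP/negPn/negP => ji; have [phi cp] := cr j jA.
have := critical_falsifies us cp xW; rewrite jx; apply.
have /satcP[u uW] : satc c W phi i by apply: cp => //; rewrite eq_sym.
by have [->|ux] := eqVneq u x; [rewrite ix | rewrite iu].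
Qed.

Lemma deg_gt1 c A W w : mu c A W -> w \in W -> 1 < deg c A w.
Proof.
by move=> m wW; rewrite degE; have := occs_gt0 true m wW; have := occs_gt0 false m wW; lia.
Qed.

(** Induction by merging: the two clauses [P] and [Q] at a variable [y] of minimum degree agree
    elsewhere, so setting [y] to false amounts to replacing both by their common part. What
    induction yields is lifted back, with [y] serving as one of the two variables. *)
Lemma mu1_smu_unit c A W : smu c A W -> #|A| = #|W| + 1 -> W != set0 ->
  unit_in c A W \/
  exists u1 u2, [/\ u1 \in W, u2 \in W, u1 != u2, deg c A u1 <= 2 & deg c A u2 <= 2].
Proof.
have [n] := ubnP #|W|; elim: n c A W => // n IH c A W lt sm cA W0.
have [y mv] : exists y, minvar c A W y.
  have /set0Pn[w0 w0W] := W0.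
  by case: (arg_minnP (deg c A) w0W) => y yW le; exists y; split.
have yW : y \in W := mv.1.
have [d r] := mu1_minvar sm mv cA.
have cW := cardsD1 y W; rewrite yW in cW.
have [us cr oc] := sm.1.
have [P PA Py] := mu_both false sm.1 yW; have [Q QA Qy] := mu_both true sm.1 yW.
have PQ : P != Q by apply/eqP => e; move: Py; rewrite e Qy.
have only : forall j, j \in A -> c j y != None -> j = P \/ j = Q.
  by apply: deg_le2_pair => //; rewrite ?Py ?Qy.
have PQe w : w \in W -> w != y -> c P w = c Q w.
  move=> wW wy; case e: (c P w) => [x|].
    by rewrite (smu_rows_eq sm yW PA QA Py Qy only wW wy e).
  case e': (c Q w) => [x|] //; rewrite -e.
  rewrite (smu_rows_eq sm yW QA PA Qy Py _ wW wy e') // => j jA /(only j jA).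
  by case; [right|left].
pose A' := res c A y false; pose W' := W :\ y.
have m' : mu c A' W' := minvar_split false sm mv.
have cA' : #|A'| = #|W'| + 1 := r false.
have QA' : Q \in A' by rewrite inE QA Qy.
have A'R j : j \in A' -> j != Q -> c j y = None.
  rewrite inE => /andP[jA jy] jQ; case e: (c j y) => [x|] //.
  by case: (only j jA); rewrite ?e // => jE; move: jy jQ; rewrite jE ?Py ?eqxx.
have sub : {subset A' <= A} by move=> j; rewrite inE => /andP[].
(* Whichever value [phi] gives to [y], one of [P] and [Q] has to be satisfied outside [y], where
   both carry the same literals. *)
have sm' : smu c A' W'.
  split=> // i w b iA'; rewrite !inE => /andP[wy wW] iw.
  have [phi cp pw] := sm.2 i w b (sub i iA') wW iw; exists phi => // j jA' ji.
  have fromA k : k \in A -> k != i -> c k y <> Some (phi y) -> satc c W' phi k.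
    move=> kA ki ky; have /satcP[u uW e] := cp k kA ki; apply/satcP; exists u => //.
    by rewrite !inE uW andbT; apply/eqP => uy; apply: ky; rewrite -uy.
  have [jQ|jQ] := eqVneq j Q; last by apply: fromA; rewrite ?sub // A'R.
  have PnA' : P != i by apply: contraTneq iA' => <-; rewrite inE PA Py.
  case py: (phi y).
    have /satcP[u] : satc c W' phi P by apply: fromA; rewrite // Py py.
    rewrite jQ => uW'; have := uW'; rewrite !inE => /andP[uy uW].
    by rewrite PQe // => e; apply/satcP; exists u.
  by rewrite jQ in ji *; apply: fromA => //; rewrite Qy py.
have [W'0|W'0] := eqVneq W' set0.
  left; exists Q, y; split=> // w wW wy.
  by move/setP/(_ w): W'0; rewrite !inE wy wW.
have lt' : #|W'| < n by rewrite /W'; lia.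
have degA w : w != y -> c Q w = None -> w \in W -> deg c A w = deg c A' w.
  move=> wy Qw wW; rewrite (deg_res c A y false) -[RHS]add0n; congr (_ + _).
  apply/eqP; rewrite cards_eq0; apply/eqP/setP => i; rewrite !inE.
  apply/negP => /andP[/andP[iA /eqP iy] iw].
  by case: (only i iA); rewrite ?iy // => iE; move: iy iw; rewrite iE ?Qy // (PQe w) // Qw.
have two u : u \in W -> u != y -> deg c A u <= 2 ->
    exists u1 u2, [/\ u1 \in W, u2 \in W, u1 != u2, deg c A u1 <= 2 & deg c A u2 <= 2].
  by move=> uW uy du; exists u, y.
case: (IH c A' W' lt' sm' cA' W'0) => [[i [x [iA' iu]]]|[u1 [u2 []]]].
  (* A unit clause other than [Q] does not contain [y], so it is one of [A] too. If it is [Q],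
     making its literal at [x] true leaves either a clause over [x] alone or a variable of degree at
     most 2 outside [Q], whose degree in [A] is the same. *)
  have [iQ|iQ] := eqVneq i Q; last first.
    left; exists i, x; split; first exact: sub.
    move=> w wW wx; have [->|wy] := eqVneq w y; first exact: A'R.
    by apply: iu; rewrite // !inE wy wW.
  rewrite {}iQ in iA' iu.
  have [/andP[xW' Qx0]|] := boolP ((x \in W') && (c Q x != None)); last first.
    move=> n0; have A1 := mu_empty m' QA'.
    have : A' = [set Q].
      apply: A1 => w wW'; have [wx|wx] := eqVneq w x; last exact: iu.
      by move: n0; rewrite -wx wW' /=; case: (c Q w).
    by move=> A'1; move: cA' W'0; rewrite A'1 cards1 -card_gt0; clear; lia.
  have [b Qx] : exists b, c Q x = Some b by case: (c Q x) Qx0 => // b; exists b.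
  have oQ : occs c A' x b = [set Q] := unit_occs m' QA' xW' Qx iu.
  have m'' : mu c (res c A' x b) (W' :\ x).
    by apply: smu_split => // w wW' _; rewrite oQ cards1 (deg_gt1 m').
  have cW' := cardsD1 x W'; rewrite xW' in cW'.
  have cA'' : #|res c A' x b| = #|W' :\ x| + 1.
    by have := card_occs_res c A' x b; rewrite oQ cards1 cA' cW'; clear; lia.
  have [W''0|W''0] := eqVneq (W' :\ x) set0.
    have /card_gt0P[k] := mu_gt0 m''; rewrite inE => /andP[kA' kx].
    left; exists k, x; split; first exact: sub.
    move=> w wW wx; have [->|wy] := eqVneq w y.
      by apply: A'R => //; apply: contraNneq kx => ->; rewrite Qx.
    by move/setP/(_ w): W''0; rewrite !inE wx wy wW.
  have [u] := mu1_deg_le2 m'' cA'' W''0; rewrite in_setD1 => /andP[ux uW'] du.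
  have /andP[uy uW] : (u != y) && (u \in W) by move: uW'; rewrite !inE.
  right; apply: (two u) => //; rewrite degA ?iu //.
  rewrite (deg_res c A' x b) oQ; apply: leq_trans du.
  rewrite -[X in _ <= X]add0n leq_add2r leqn0 cards_eq0; apply/eqP/setP => k; rewrite !inE.
  by case: eqP => [->|] //=; rewrite iu.
rewrite !inE => /andP[u1y u1W] /andP[u2y u2W] u12 d1 d2.
case e1: (c Q u1) => [b1|]; last by right; apply: (two u1); rewrite // degA.
case e2: (c Q u2) => [b2|]; last by right; apply: (two u2); rewrite // degA.
(* Both variables occur in [Q]. The other clause [X] at [u1] agrees with [Q] at [u2], so both
   occurrences of [u2] have the same sign, against [mu_both]. *)
exfalso.
have u1W' : u1 \in W' by rewrite !inE u1y.
have u2W' : u2 \in W' by rewrite !inE u2y.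
have [X XA Xu1] := mu_both (~~ b1) m' u1W'.
have XQ : Q != X by apply/eqP => e; move: Xu1; rewrite -e e1; case: (b1).
have onl := deg_le2_pair d1 QA' XA XQ; rewrite e1 Xu1 in onl; have {}onl := onl isT isT.
have Xu2 := smu_rows_eq sm' u1W' QA' XA e1 Xu1 onl u2W' _ e2.
rewrite eq_sym in u12; have {}Xu2 := Xu2 u12.
have [Z ZA Zu2] := mu_both (~~ b2) m' u2W'.
have := deg_le2_pair d2 QA' XA XQ; rewrite e2 Xu2 => /(_ isT isT Z ZA).
rewrite Zu2 => /(_ isT) [] E; move: Zu2; rewrite E ?e2 ?Xu2; by case: (b2).
Qed.

Lemma subc_unit c c' A W : subc c c' -> unit_in c' A W -> unit_in c A W.
Proof.
move=> s [i [x [iA iu]]]; exists i, x; split=> // w wW wx.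
by case e: (c i w) => [b|] //; move: (s _ _ _ e); rewrite iu.
Qed.

Lemma mu1_unit c A W : mu c A W -> #|A| = #|W| + 1 -> W != set0 ->
  unit_in c A W \/
  exists u1 u2, [/\ u1 \in W, u2 \in W, u1 != u2, deg c A u1 <= 2 & deg c A u2 <= 2].
Proof.
move=> m cA W0; have [c' s sm] := saturate m.
case: (mu1_smu_unit sm cA W0) => [/(subc_unit s)|[u1 [u2 [? ? ? d1 d2]]]]; first by left.
right; exists u1, u2; split=> //;
  [apply: leq_trans d1|apply: leq_trans d2]; exact: subc_deg.
Qed.

(** * Deficiency 2 with all degrees at least 4 *)

Section Deficiency2.
Variables (c : T -> V -> option bool) (A : {set T}) (W : {set V}).
Hypotheses (sm : smu c A W) (cA : #|A| = #|W| + 2) (W3 : 2 < #|W|).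
Hypotheses (d4 : forall w, w \in W -> 4 <= deg c A w) (nu : ~ unit_in c A W).

Lemma deg4_minvar w : w \in W -> deg c A w = 4 -> minvar c A W w.
Proof. by move=> wW e; split=> // u uW; rewrite e; exact: d4. Qed.

Lemma deg4_occs w b : w \in W -> deg c A w = 4 -> #|occs c A w b| = 2.
Proof.
move=> wW e; have mv := deg4_minvar wW e; move: e; rewrite (degEb c A w b).
have [_ + _] := minvar_occs b sm mv cA; have [_ + _] := minvar_occs (~~ b) sm mv cA; lia.
Qed.

Lemma deg4_res w b : w \in W -> deg c A w = 4 -> #|res c A w b| = #|W :\ w| + 1.
Proof.
move=> wW e; have [_ _ ->] := minvar_occs b sm (deg4_minvar wW e) cA.
by rewrite deg4_occs.
Qed.

(** At least 4 occurrences minus 2 removed clauses leave at least 2, so all estimates are equalities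
    and [u] is in both removed clauses. It keeps one of two occurrences of each sign, so the removed
    ones differ in sign. *)
Lemma deg4_res_low w b u : w \in W -> deg c A w = 4 -> u \in W :\ w ->
    deg c (res c A w b) u <= 2 ->
  [/\ deg c A u = 4, forall i, i \in occs c A w b -> c i u != None
    & forall b', exists2 i, i \in occs c A w b & c i u = Some b'].
Proof.
move=> wW e uW' du; have uW : u \in W by move: uW'; rewrite !inE => /andP[].
have du4 := d4 uW; have o2 := deg4_occs b wW e.
have m' := minvar_split b sm (deg4_minvar wW e).
have sub : [set i in occs c A w b | c i u != None] \subset occs c A w b.
  by apply/subsetP => i; rewrite inE => /andP[].
have le := subset_leq_card sub; have du_eq := deg_res c A w b u.
have du' : deg c A u = 4 by lia.
have /eqP/setP all : [set i in occs c A w b | c i u != None] == occs c A w b.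
  by rewrite eqEcard sub; lia.
have occ i : i \in occs c A w b -> c i u != None.
  by move=> io; move: (all i); rewrite inE io.
split=> // b'.
have o1 : #|occs c (res c A w b) u b'| = 1.
  move: du; rewrite (degEb _ _ _ b').
  have := occs_gt0 b' m' uW'; have := occs_gt0 (~~ b') m' uW'; lia.
have := deg4_occs b' uW du'.
rewrite -(cardsID (res c A w b)) => o.
have : 0 < #|occs c A u b' :\: res c A w b|.
  suff : #|occs c A u b' :&: res c A w b| = 1 by lia.
  by rewrite -o1; apply: eq_card => i; rewrite !inE; case: (i \in A); case: (c i u == _); case: (c i w == _).
case/card_gt0P => i; rewrite !inE => /andP[+ /andP[iA /eqP iu]]; rewrite iA /= negbK => iw.
by exists i => //; rewrite inE iA.
Qed.

Definition nvars i := #|[set w in W | c i w != None]|.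

(** [S] is a unit clause after setting [w] to [~~ b]. If there were none, two variables of small
    degree would make the two removed clauses clash twice, although both survive the other split, of
    deficiency 1. The variable [w'] is one of small degree after that other split. *)
Lemma deg4_literal w b : w \in W -> deg c A w = 4 ->
  exists S Lg w' b', [/\ [/\ w' \in W, w' != w & deg c A w' = 4],
    [/\ S \in A, c S w = Some b, c S w' = Some b' & nvars S <= 2],
    [/\ Lg \in A, c Lg w = Some b, c Lg w' = Some (~~ b') & 2 < nvars Lg]
    & forall j, j \in A -> c j w = Some b -> j = S \/ j = Lg].
Proof.
move=> wW e; have W1 : 1 < #|W| by lia.
have W'0 := setD1_neq0 wW W1; have mv := deg4_minvar wW e.
have m' b' := minvar_split b' sm mv.
have clash b' u : u \in W :\ w -> deg c (res c A w b') u <= 2 ->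
    forall i j, i \in occs c A w b' -> j \in occs c A w b' -> i != j ->
    exists x, c i u = Some x /\ c j u = Some (~~ x).
  move=> uW' du i j io jo ij; have [_ _ both] := deg4_res_low wW e uW' du.
  have o2 := deg4_occs b' wW e.
  have /eqP/setP all : [set i; j] == occs c A w b'.
    by rewrite eqEcard cards2 ij o2 leqnn andbT; apply/subsetP => k; rewrite !inE => /orP[]/eqP->;
       [move: io|move: jo]; rewrite inE.
  have [k1] := both true; rewrite -all !inE => k1ij e1.
  have [k2] := both false; rewrite -all !inE => k2ij e2.
  by move: e1 e2; case/orP: k1ij => /eqP ->; case/orP: k2ij => /eqP -> -> //;
     [exists true|move=> ->; exists false].
have [S [x [SH Su]]] : unit_in c (res c A w (~~ b)) (W :\ w).
  case: (mu1_unit (m' (~~ b)) (deg4_res (~~ b) wW e) W'0) => [h|[u1 [u2 [u1W u2W u12 l1 l2]]]]; first exact: h.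
  have /cards2P[i [j [ij E]]] : #|occs c A w (~~ b)| == 2 by apply/eqP; exact: deg4_occs.
  have io : i \in occs c A w (~~ b) by rewrite E !inE eqxx.
  have jo : j \in occs c A w (~~ b) by rewrite E !inE eqxx orbT.
  have inr k : k \in occs c A w (~~ b) -> k \in res c A w b.
    by rewrite !inE => /andP[-> /eqP->]; case: (b).
  have [x1 [i1 j1]] := clash _ _ u1W l1 i j io jo ij.
  have [x2 [i2 j2]] := clash _ _ u2W l2 i j io jo ij.
  by case/eqP: u12; apply: (mu1_clash (m' b) (deg4_res b wW e) (inr _ io) (inr _ jo)) i1 j1 i2 j2.
have SA : S \in A by move: SH; rewrite inE => /andP[].
have Sw : c S w = Some b.
  move: SH; rewrite inE SA /=; case Sw: (c S w) => [b'|].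
    by case: (b') (b) => [] [].
  case: nu; exists S, x; split=> // u uW ux; have [->//|uw] := eqVneq u w.
  by apply: Su; rewrite // !inE uw.
have [/andP[xW' Sx]|no] := boolP ((x \in W :\ w) && (c S x != None)); last first.
  case: nu; exists S, w; split=> // u uW uw.
  have uW' : u \in W :\ w by rewrite !inE uw.
  have [ux|ux] := eqVneq u x; last exact: Su.
  by move: no; rewrite -ux uW' /=; case: (c S u).
have [b' Sb'] : exists b', c S x = Some b' by case: (c S x) Sx => // b'; exists b'.
have [u uW' du] := mu1_deg_le2 (m' b) (deg4_res b wW e) W'0.
have So : S \in occs c A w b by rewrite inE SA Sw eqxx.
have [du4 uo _] := deg4_res_low wW e uW' du.
have ux : u = x by apply/eqP/negPn/negP => ux; have := uo S So; rewrite Su.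
rewrite {}ux in du du4 uo uW'.
have /cards2P[i [j [ij E]]] : #|occs c A w b| == 2 by apply/eqP; exact: deg4_occs.
have [Lg SL EL] : exists2 Lg, S != Lg & occs c A w b = [set S; Lg].
  have := So; rewrite {1}E !inE => /orP[]/eqP SE.
    by exists j; rewrite SE.
  by exists i; rewrite SE; [rewrite eq_sym|rewrite E setUC].
have Lo : Lg \in occs c A w b by rewrite EL !inE eqxx orbT.
have /andP[LA /eqP Lw] : (Lg \in A) && (c Lg w == Some b) by move: Lo; rewrite inE.
have Lx : c Lg x = Some (~~ b').
  by have [y [Sy ->]] := clash _ _ uW' du S Lg So Lo SL; move: Sy; rewrite Sb' => -[->].
have /andP[xw xW] : (x != w) && (x \in W) by move: xW'; rewrite !inE.
exists S, Lg, x, b'; split=> //.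
- split=> //; have <- : #|[set w; x]| = 2 by rewrite cards2 eq_sym xw.
  apply: subset_leq_card; apply/subsetP => y; rewrite !inE => /andP[yW ny].
  apply/negPn/negP; rewrite negb_or => /andP[yw yx].
  by move: ny; rewrite Su // !inE yw.
(* If [Lg] were binary, the split on [~~ b] would contain two contradictory unit clauses and hence
   nothing else, against [2 < #|W|]. *)
- split=> //; rewrite ltnNge; apply/negP => n2.
  have /eqP/setP E2 : [set w; x] == [set y in W | c Lg y != None].
    rewrite eqEcard cards2 eq_sym xw n2 andbT.
    by apply/subsetP => y; rewrite !inE => /orP[]/eqP->; rewrite ?wW ?xW ?Lw ?Lx.
  have Lu y : y \in W :\ w -> y != x -> c Lg y = None.
    rewrite !inE => /andP[yw yW] yx; have := E2 y.
    by rewrite !inE (negbTE yw) (negbTE yx) yW /=; case: (c Lg y).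
  have LH : Lg \in res c A w (~~ b) by rewrite inE LA Lw; case: (b).
  have : res c A w (~~ b) \subset [set S; Lg].
    apply/subsetP => k kH; rewrite !inE; apply/negPn/negP; rewrite negb_or => /andP[kS kL].
    have [_ cr _] := m' (~~ b); have [phi cp] := cr k kH.
    have only_x l : l \in res c A w (~~ b) -> k != l ->
        (forall y, y \in W :\ w -> y != x -> c l y = None) -> c l x = Some (phi x).
      move=> lH kl lu; have /satcP[y yW'] : satc c (W :\ w) phi l by apply: cp; rewrite // eq_sym.
      by have [->//|yx] := eqVneq y x; rewrite lu.
    have := only_x S SH kS Su; have := only_x Lg LH kL Lu; rewrite Lx Sb' => -[<-].
    by case: (b').
  move/subset_leq_card; rewrite cards2 SL deg4_res //.
  by move: W3; rewrite (cardsD1 w W) wW add1n addn1 ltnNge => /negP.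
- move=> k kA kw; have : k \in occs c A w b by rewrite inE kA kw eqxx.
  by rewrite EL !inE => /orP[]/eqP; [left|right].
Qed.

End Deficiency2.

Lemma nvars_le2_mem c W i x y z : x \in W -> y \in W -> x != y ->
  c i x != None -> c i y != None -> nvars c W i <= 2 ->
  z \in W -> c i z != None -> z = x \/ z = y.
Proof.
move=> xW yW xy ix iy n2 zW iz.
have : [set x; y] == [set w in W | c i w != None].
  rewrite eqEcard cards2 xy n2 andbT; apply/subsetP => w.
  by rewrite !inE => /orP[]/eqP->; rewrite ?xW ?yW.
by move=> /eqP/setP/(_ z); rewrite !inE zW iz => /orP[]/eqP; [left|right].
Qed.

Lemma leq_cardsD1 (I : finType) (x : I) (S : {set I}) : #|S| <= #|S :\ x|.+1.
Proof. by rewrite (cardsD1 x S); case: (x \in S). Qed.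

Definition opp (l : V * bool) : V * bool := (l.1, ~~ l.2).

Lemma oppK : involutive opp.
Proof. by case=> w b; rewrite /opp negbK. Qed.

(* Each literal [l] over the variables of degree 4 lies in one binary clause [sh l = {l, g l}] and one
   longer clause [lg l], which contains the negation of [g l]. Both [lg l] and [lg (opp l)] are invariant
   along the orbit [L] of [l0] under [f l = g (opp l)], so [L] is an implication cycle closed up by
   the two clauses [P] and [Q]. Removing [P] and the binary clauses of the cycle leaves an MU of deficiency 1 on the
   other variables, all of whose degrees drop by at most 1, i.e. stay above 2. *)
Lemma smu2_deg_eq4 c A W : smu c A W -> #|A| = #|W| + 2 -> 2 < #|W| ->
  (forall w, w \in W -> 4 <= deg c A w) -> ~ unit_in c A W ->
  forall w, w \in W -> deg c A w = 4.
Proof.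
move=> sm cA W3 d4 nu.
have [us cr oc] := sm.1.
pose lit := (V * bool)%type.
pose L4 (l : lit) := (l.1 \in W) && (deg c A l.1 == 4).
pose inc i (l : lit) := c i l.1 = Some l.2.
have [l0 l0L] : exists l0, L4 l0.
  have [w wW dw] := mu2_deg_le4 sm.1 cA; exists (w, true).
  by rewrite /L4 /= wW eqn_leq dw d4.
have [t0 t0A] : exists t, t \in A by apply/card_gt0P; rewrite cA; lia.
have [h hP] : exists h : lit -> T * T * lit, forall l, L4 l ->
   let: (Sh, Lg, l') := h l in
   [/\ [/\ L4 l', l'.1 != l.1 & forall j, j \in A -> inc j l -> j = Sh \/ j = Lg],
       [/\ Sh \in A, inc Sh l, inc Sh l' & nvars c W Sh <= 2] &
       [/\ Lg \in A, inc Lg l, inc Lg (opp l') & 2 < nvars c W Lg]].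
  apply: (@fin_all_exists lit (fun _ => (T * T * lit)%type) (fun l r => L4 l ->
    let: (Sh, Lg, l') := r in _)) => -[w b].
  have [/andP[wW /eqP dw]|] := boolP (L4 (w, b)); last by exists (t0, t0, l0).
  have [Sh [Lg [w' [b' [[w'W w'w dw'] [SA Sw Sw' S2] [LA Lw Lw' L2] only]]]]] :=
    deg4_literal sm cA W3 d4 nu b wW dw.
  exists (Sh, Lg, (w', b')) => _; split; split=> //.
  by rewrite /L4 /= w'W dw'.
pose sh l := (h l).1.1; pose lg l := (h l).1.2; pose g l := (h l).2.
have {}hP l : L4 l ->
   [/\ [/\ L4 (g l), (g l).1 != l.1 & forall j, j \in A -> inc j l -> j = sh l \/ j = lg l],
       [/\ sh l \in A, inc (sh l) l, inc (sh l) (g l) & nvars c W (sh l) <= 2] &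
       [/\ lg l \in A, inc (lg l) l, inc (lg l) (opp (g l)) & 2 < nvars c W (lg l)]].
  by move=> /hP; rewrite /sh /lg /g; case: (h l) => -[Sh Lg] l'.
move: sh lg g hP => sh lg g {h} hP.
have L4opp l : L4 l -> L4 (opp l) by [].
have incN i l : inc i l -> c i l.1 != None by move=> ->.
have inc_opp i l : inc i l -> inc i (opp l) -> False.
  by rewrite /inc => ->; case: l => w [].
have L4W l : L4 l -> l.1 \in W by case/andP.
have sh_vars l w : L4 l -> w \in W -> c (sh l) w != None -> w = l.1 \/ w = (g l).1.
  move=> lL wW; have [[gL gl _] [_ /incN s1 /incN s2 n2] _] := hP l lL.
  by apply: (nvars_le2_mem (L4W _ lL) (L4W _ gL) _ s1 s2 n2) wW; rewrite eq_sym.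
have inc_eq i l l' : inc i l -> inc i l' -> l.1 = l'.1 -> l = l'.
  by case: l l' => [w b] [w' b']; rewrite /inc /= => + + e; rewrite e => -> [->].
have shg l : L4 l -> sh (g l) = sh l.
  move=> lL; have [[gL gl _] [sA s1 s2 n2] _] := hP l lL.
  have [[_ _ only] _ [_ _ _ n3]] := hP _ gL.
  by case: (only _ sA s2) => // e; rewrite -e ltnNge n2 in n3.
have gK l : L4 l -> g (g l) = l.
  move=> lL; have [[gL gl _] [_ s1 _ _] _] := hP l lL.
  have [[ggL ggl _] [_ _ s3 _] _] := hP _ gL; rewrite shg // in s3.
  apply: (inc_eq _ _ _ s3 s1); case: (sh_vars l _ lL (L4W _ ggL) (incN _ _ s3)) => // e.
  by rewrite e eqxx in ggl.
have lgg l : L4 l -> lg (opp (g l)) = lg l.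
  move=> lL; have [[gL gl _] _ [lA _ l2 n3]] := hP l lL.
  have [[_ _ only] [_ _ _ n2] _] := hP _ (L4opp _ gL).
  by case: (only _ lA l2) => // e; rewrite e ltnNge n2 in n3.
(* Being the identity off [L4], [f] is injective on the whole type, so its orbits are cycles. *)
pose f l := if L4 l then g (opp l) else l.
have fL l : L4 l -> L4 (f l).
  by move=> lL; rewrite /f lL; have [[]] := hP _ (L4opp _ lL).
have fE l : L4 l -> f l = g (opp l) by rewrite /f => ->.
have finj : injective f.
  apply: (can_inj (g := fun l => if L4 l then opp (g l) else l)) => l.
  case lL: (L4 l); last by rewrite /f lL /= lL.
  by rewrite fL // fE // gK ?oppK.
have lgf l : L4 l -> lg (f l) = lg l.
  by move=> lL; rewrite -(lgg (f l)) ?fL // fE // gK // oppK.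
have lgof l : L4 l -> lg (opp (f l)) = lg (opp l).
  by move=> lL; rewrite fE // lgg.
pose L := [set l | fconnect f l0 l].
have Lind (Pr : lit -> Prop) : Pr l0 -> (forall l, l \in L -> Pr l -> Pr (f l)) ->
    forall l, l \in L -> Pr l.
  move=> p0 ps l; rewrite inE => /iter_findex <-.
  elim: (findex f l0 l) => //= n IH; apply: ps => //; rewrite inE; exact: fconnect_iter.
have LL4 l : l \in L -> L4 l by apply: (Lind L4) => // x _; exact: fL.
have lfL l : l \in L -> f l \in L.
  by rewrite !inE => h; apply: connect_trans h (fconnect1 f l).
have fpre l : l \in L -> exists2 l', l' \in L & f l' = l.
  move=> lL; exists (finv f l); last exact: f_finv.
  rewrite inE; move: lL; rewrite inE => h; apply: connect_trans h _.
  exact: fconnect_finv.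
pose P := lg l0; pose Q := lg (opp l0).
have LP l : l \in L -> lg l = P.
  by apply: (Lind (fun l => lg l = P)) => // x xL <-; rewrite lgf ?LL4.
have LQ l : l \in L -> lg (opp l) = Q.
  by apply: (Lind (fun l => lg (opp l) = Q)) => // x xL <-; rewrite lgof ?LL4.
have PA : P \in A by have [_ _ []] := hP l0 l0L.
have Pl l : l \in L -> inc P l by move=> lL; rewrite -(LP l lL); have [_ _ []] := hP l (LL4 l lL).
have Ql l : l \in L -> inc Q (opp l).
  by move=> lL; rewrite -(LQ l lL); have [_ _ []] := hP _ (L4opp _ (LL4 l lL)).
have noopp l : l \in L -> opp l \in L -> False.
  by move=> /Pl p /Pl; exact: inc_opp.
have Linj : {in L &, injective (fun l : lit => l.1)}.
  by move=> l l' /Pl p /Pl p'; exact: (inc_eq _ _ _ p p').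
pose SH := [set sh (opp l) | l in L].
pose VL := [set l.1 | l in L].
have shP l : l \in L -> [/\ sh (opp l) \in A, inc (sh (opp l)) (opp l), inc (sh (opp l)) (f l)
    & nvars c W (sh (opp l)) <= 2].
  by move=> lL; rewrite fE ?LL4 //; have [_ [] ] := hP _ (L4opp _ (LL4 l lL)).
have sh_f l : l \in L -> sh (f l) = sh (opp l).
  by move=> lL; have lL4 := LL4 l lL; rewrite fE // shg.
have l0inL : l0 \in L by rewrite inE connect0.
have touch i l : i \in A -> l \in L -> c i l.1 != None -> [\/ i = P, i = Q | i \in SH].
  move=> iA lL ci.
  have [il|il] : inc i l \/ inc i (opp l).
    by case: l {lL} ci => w b; rewrite /inc /=; case: (c i w) => // x _; case: x b => [] []; [left|right|right|left].
  - have [[_ _ only] _ _] := hP l (LL4 l lL).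
    case: (only i iA il) => ->; last by constructor 1; exact: LP.
    have [l' l'L <-] := fpre l lL; constructor 3; rewrite sh_f //; exact: imset_f.
  - have [[_ _ only] _ _] := hP _ (L4opp _ (LL4 l lL)).
    case: (only i iA il) => ->; last by constructor 2; exact: LQ.
    constructor 3; exact: imset_f.
have cSH : #|SH| = #|L|.
  apply: card_in_imset => l l' lL l'L e.
  have [_ s1 s2 _] := shP l lL; have [_ s1' s2' _] := shP l' l'L.
  have := sh_vars _ _ (L4opp _ (LL4 l' l'L)) (L4W _ (LL4 l lL)).
  rewrite -e => /(_ (incN _ _ s1)) [E|E].
    by apply: Linj.
  rewrite -fE ?LL4 // in E; rewrite -e in s2'.
  by have := inc_eq _ _ _ s1 s2' E => oe; case: (noopp l lL); rewrite oe lfL.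
have PSH : P \notin SH.
  apply/imsetP => -[l lL e]; have [_ _ [_ _ _ n3]] := hP l0 l0L.
  by have [_ _ _] := shP l lL; rewrite -e leqNgt n3.
have SHA : SH \subset A by apply/subsetP => i /imsetP[l /shP[? _ _ _] ->].
have cVL : #|VL| = #|L| by exact: card_in_imset.
have VLW : VL \subset W by apply/subsetP => w /imsetP[l /LL4/L4W lW ->].
have VL4 w : w \in VL -> deg c A w = 4 by move=> /imsetP[l /LL4/andP[_ /eqP d] ->].
have [W0|/set0Pn[u0 u0W]] := eqVneq (W :\: VL) set0.
  move=> w wW; apply: VL4; move/setP/(_ w): W0; rewrite !inE wW andbT.
  by move/negbFE.
exfalso.
pose X := A :\: (P |: SH).
(* [#|L| + 1] clauses and [#|L|] variables disappear. *)
have cX : #|X| = #|W :\: VL| + 1.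
  have := cardsID (P |: SH) A; have := cardsID VL W.
  rewrite (setIidPr VLW) (setIidPr _) ?cardsU1 ?PSH ?cSH ?cVL; last first.
    by apply/subsetP => i; rewrite !inE => /orP[/eqP->//|]; exact: (subsetP SHA).
  rewrite -/X cA; clear; lia.
have XA i : i \in X -> i \in A by rewrite inE => /andP[].
have Xl i l : i \in X -> l \in L -> c i l.1 != None -> i = Q.
  move=> iX lL ci; move: (iX); rewrite !inE negb_or => /andP[/andP[iP iS] iA].
  by case: (touch i l iA lL ci) iP iS => // ->; rewrite ?eqxx //; move=> ->.
have mX : mu c X (W :\: VL).
  split.
  - apply/negP => /existsP[phi /forallP hphi].
    (* Making all literals of [L] true satisfies [P] and the binary clauses, so a model of [X] would
       extend to [A]. *)
    pose psi : {ffun V -> bool} :=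
      [ffun w => if (w, true) \in L then true else if (w, false) \in L then false else phi w].
    have psiL l : l \in L -> psi l.1 = l.2.
      case: l => w [] lL; rewrite ffunE lL //=.
      by case: ifP => // h; case: (noopp _ lL).
    have psiN w : w \notin VL -> psi w = phi w.
      move=> wV; rewrite ffunE; case: ifP => [h|_].
        by case/imsetP: wV; exists (w, true).
      by case: ifP => // h; case/imsetP: wV; exists (w, false).
    have [i iA n] := unsatP psi us.
    have [iX|] := boolP (i \in X).
      move: (hphi i); rewrite iX /= => /satcP[w]; rewrite inE => /andP[wV wW] e.
      by case: (n w wW); rewrite psiN.
    rewrite inE iA andbT negbK !inE => /orP[/eqP iP|/imsetP[l lL iS]].
      by case: (n l0.1 (L4W _ l0L)); rewrite psiL // iP; exact: Pl.
    have [_ _ s2 _] := shP l lL; have flL := lfL l lL.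
    by case: (n _ (L4W _ (LL4 _ flL))); rewrite psiL // iS.
  - move=> i iX; have iA := XA i iX.
    (* An assignment following [L] satisfies no literal of [Q] on the cycle. For [i = Q] it is
       forced, since [Q] is falsified; otherwise saturation makes [l0] true and the binary clauses
       propagate this along the cycle. *)
    have [phi cp pL] : exists2 phi, critical c A W i phi & forall l, l \in L -> phi l.1 = l.2.
      have [iQ|iQ] := eqVneq i Q.
        have [phi cp] := cr i iA; exists phi => // l lL.
        have := critical_falsifies us cp (L4W _ (LL4 l lL)).
        by have := Ql l lL; rewrite /inc iQ => ->; case: (l) => w [] /=; case: (phi w).
      have il : c i l0.1 = None.
        by case e: (c i l0.1) => [x|] //; case/eqP: iQ; apply: (Xl i l0); rewrite ?e.
      have [phi cp p0] := sm.2 i l0.1 l0.2 iA (L4W _ l0L) il; exists phi => //.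
      apply: (Lind (fun l => phi l.1 = l.2)) => // l lL pl.
      have [sA s1 s2 _] := shP l lL.
      have si : sh (opp l) != i.
        apply: contraTneq iX => <-; rewrite !inE negb_and negbK; apply/orP; left.
        by rewrite (imset_f (fun l => sh (opp l)) lL) orbT.
      have /satcP[u uW e] := cp _ sA si.
      have := sh_vars _ _ (L4opp _ (LL4 l lL)) uW; rewrite e => /(_ isT) [] E.
        by move: s1 e; rewrite /inc E => -> /=; rewrite pl; case: (l.2).
      by rewrite -fE ?LL4 // in E; move: s2 e; rewrite /inc E => -> [->].
    exists phi => j jX ji; have /satcP[u uW e] := cp j (XA j jX) ji.
    apply/satcP; exists u => //; rewrite inE uW andbT; apply/imsetP => -[l lL ul].
    have jQ : j = Q by apply: (Xl j l) => //; rewrite -ul e.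
    by move: e; rewrite jQ ul pL //; have := Ql l lL; rewrite /inc /= => ->; case: (l.2).
  - move=> w; rewrite inE => /andP[wV wW].
    have : 0 < #|[set i in A | c i w != None] :\ P|.
      by rewrite -ltnS; apply: leq_trans (leq_cardsD1 _ _); apply: leq_trans (d4 w wW).
    move=> /card_gt0P[i]; rewrite !inE => /andP[iP /andP[iA iw]]; exists i => //.
    rewrite !inE iA (negbTE iP) andbT /=; apply/imsetP => -[l lL e].
    have := sh_vars _ _ (L4opp _ (LL4 l lL)) wW; rewrite -e => /(_ iw) [] E.
      by case/imsetP: wV; exists l.
    by case/imsetP: wV; exists (f l); [exact: lfL|rewrite fE ?LL4].
have [u uW du] : exists2 u, u \in W :\: VL & deg c X u <= 2.
  by apply: mu1_deg_le2 => //; apply/set0Pn; exists u0.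
move: uW; rewrite inE => /andP[uV uW].
have : #|[set i in A | c i u != None] :\ P| <= deg c X u.
  apply: subset_leq_card; apply/subsetP => i; rewrite !inE => /andP[iP /andP[iA iw]].
  rewrite iA iw (negbTE iP) !andbT /=; apply/imsetP => -[l lL e].
  have := sh_vars _ _ (L4opp _ (LL4 l lL)) uW; rewrite -e => /(_ iw) [] E.
    by case/imsetP: uV; exists l.
  by case/imsetP: uV; exists (f l); [exact: lfL|rewrite fE ?LL4].
rewrite leqNgt => /negP; apply; apply: leq_ltn_trans du _; rewrite -ltnS.
by apply: leq_trans (leq_cardsD1 P _); exact: d4.
Qed.

(** * Deficiency 6 *)

(** At most two variables means at most 4 clauses; with more variables the degrees in a saturation
    are upper bounds. *)
Lemma mu2_deg_eq4 c A W : mu c A W -> #|A| = #|W| + 2 ->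
  (forall w, w \in W -> 4 <= deg c A w) -> ~ unit_in c A W ->
  forall w, w \in W -> deg c A w = 4.
Proof.
move=> m cA d4 nu w wW; apply/eqP; rewrite eqn_leq d4 // andbT.
have [W3|W3] := ltnP 2 #|W|; last by have := deg_le_card c A w; lia.
have [c' s sm] := saturate m.
rewrite -(smu2_deg_eq4 sm cA W3 _ _ wW); first exact: subc_deg.
  by move=> u uW; apply: leq_trans (d4 u uW) _; exact: subc_deg.
by move=> /(subc_unit s).
Qed.

(** In a saturation some sign occurs 3 times at a variable [v] of minimum degree. That split has
    deficiency 1, and its variable of degree at most 2 had degree at most 5 before, hence so had
    [v]; one of the two differs from [t]. *)
Lemma mu3_two_deg_le5 c A W t : mu c A W -> #|A| = #|W| + 3 ->
  (forall w, w \in W -> 5 <= deg c A w) -> exists u, [/\ u \in W, u != t & deg c A u <= 5].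
Proof.
move=> m cA d5; have W1 := mu_vars_gt1 m cA isT.
have W0 : W != set0 by rewrite -card_gt0 (ltn_trans _ W1).
have [c' [v [s sm mv]]] := saturate_minvar m W0.
have [b eb] : exists b, #|occs c' A v b| = 3.
  have := leq_trans (d5 v mv.1) (subc_deg A v s); rewrite degE => le.
  have [_ e1 _] := minvar_occs true sm mv cA; have [_ e2 _] := minvar_occs false sm mv cA.
  have [e|e] : #|occs c' A v true| = 3 \/ #|occs c' A v false| = 3 by lia.
    by exists true.
  by exists false.
have [_ _ r] := minvar_occs b sm mv cA; rewrite eb in r.
have [w] := mu1_deg_le2 (minvar_split b sm mv) r (setD1_neq0 mv.1 W1).
rewrite !inE => /andP[wv wW] dw.
have dw5 : deg c' A w <= 5 by apply: leq_trans (deg_res_le c' A v b w) _; rewrite eb; lia.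
have [wt|wt] := eqVneq w t.
  exists v; split; [exact: mv.1|by rewrite eq_sym -wt|].
  by apply: leq_trans (subc_deg A v s) _; apply: leq_trans (mv.2 w wW) _.
by exists w; split=> //; apply: leq_trans (subc_deg A w s) _.
Qed.

Lemma mu_rows_inj c A W i j : mu c A W -> i \in A -> j \in A ->
  (forall w, w \in W -> c i w = c j w) -> i = j.
Proof.
move=> [us cr _] iA jA e; apply/eqP/negPn/negP => ij; have [phi cp] := cr i iA.
have /satcP[w wW ew] : satc c W phi j by apply: cp; rewrite // eq_sym.
by apply: (critical_falsifies us cp wW); rewrite e.
Qed.

Section Deficiency6.
Variables (c : T -> V -> option bool) (A : {set T}) (W : {set V}).
Hypotheses (sm : smu c A W) (cA : #|A| = #|W| + 6).
Hypothesis (d9 : forall w, w \in W -> 9 <= deg c A w).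
(** The instance is a smallest counterexample; [IH] serves to eliminate a unit clause, which
    preserves the deficiency. *)
Hypothesis IH : forall A' W', #|W'| < #|W| -> mu c A' W' -> #|A'| = #|W'| + 6 ->
  exists2 w, w \in W' & deg c A' w <= 8.

Let W1 : 1 < #|W|. Proof. exact: mu_vars_gt1 sm.1 cA isT. Qed.

(** A sign occurring 6 times gives deficiency 1 and some degree at most 2 + 6, which is too small;
    one occurring 5 times gives deficiency 2 and minimum degree at most 4 + 5. *)
Lemma six_type v : minvar c A W v ->
  deg c A v = 9 /\ exists2 b, #|occs c A v b| = 5 & #|occs c A v (~~ b)| = 4.
Proof.
move=> mv; have W'0 := setD1_neq0 mv.1 W1.
have le5 b : #|occs c A v b| <= 5.
  have [_ e6 r] := minvar_occs b sm mv cA; rewrite leqNgt; apply/negP => gt.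
  have e : #|occs c A v b| = 6 by lia.
  rewrite e in r; have [w] := mu1_deg_le2 (minvar_split b sm mv) r W'0.
  rewrite !inE => /andP[_ wW] dw; have := d9 wW; have := deg_res_le c A v b w; lia.
have le9 b : #|occs c A v b| = 5 -> deg c A v <= 9.
  move=> e; have [_ _ r] := minvar_occs b sm mv cA; rewrite e in r.
  have [w] := mu2_deg_le4 (minvar_split b sm mv) r.
  rewrite !inE => /andP[_ wW] dw; have := mv.2 w wW; have := deg_res_le c A v b w; lia.
have := d9 mv.1; have := le5 true; have := le5 false; have := le9 true; have := le9 false.
rewrite degE => l1 l2 l3 l4 l5.
have [e|e] : #|occs c A v true| = 5 \/ #|occs c A v false| = 5 by lia.
  by have := l2 e; split; [lia|exists true; rewrite //=; lia].
by have := l1 e; split; [lia|exists false; rewrite //=; lia].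
Qed.

Lemma six_no_unit v b : minvar c A W v -> #|occs c A v b| = 5 ->
  ~ unit_in c (res c A v b) (W :\ v).
Proof.
move=> mv e5 [i [x [iG iu]]]; have vW := mv.1.
have [d _] := six_type mv.
have e4 : #|occs c A v (~~ b)| = 4 by move: d; rewrite (degEb c A v b); lia.
have iA : i \in A by move: iG; rewrite inE => /andP[].
case iv: (c i v) => [b'|].
  (* [i] is binary on [v], [x]: after the other split every variable but [x] has degree at least 6. *)
  have iK : i \in occs c A v (~~ b).
    by move: iG; rewrite !inE iA iv; case: (b') (b) => [] [].
  have [_ _ r] := minvar_occs (~~ b) sm mv cA; rewrite e4 in r.
  have [|u [uW' ux du]] := mu3_two_deg_le5 x (minvar_split (~~ b) sm mv) r.
    move=> w; rewrite !inE => /andP[_ wW]; have := d9 wW.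
    by have := deg_res_le c A v (~~ b) w; lia.
  have /andP[uv uW] : (u != v) && (u \in W) by move: uW'; rewrite !inE.
  have := d9 uW; rewrite (deg_res c A v (~~ b)).
  have : #|[set k in occs c A v (~~ b) | c k u != None]| <= #|occs c A v (~~ b) :\ i|.
    apply: subset_leq_card; apply/subsetP => k; rewrite inE in_setD1 => /andP[-> ku].
    by rewrite andbT; apply: contraNneq ku => ->; rewrite iu.
  have := cardsD1 i (occs c A v (~~ b)); rewrite iK e4; lia.
(* [i] is a unit clause of the whole instance and can be eliminated. *)
have iu' w : w \in W -> w != x -> c i w = None.
  by move=> wW wx; have [->//|wv] := eqVneq w v; apply: iu; rewrite // !inE wv.
have [/andP[xW ix]|no] := boolP ((x \in W) && (c i x != None)); last first.
  have A1 : A = [set i].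
    apply: (mu_empty sm.1 iA) => w wW; have [wx|wx] := eqVneq w x; last exact: iu'.
    by move: no; rewrite -wx wW /=; case: (c i w).
  by move: cA; rewrite A1 cards1; lia.
have [b' ib'] : exists b', c i x = Some b' by case: (c i x) ix => // b'; exists b'.
have ox := unit_occs sm.1 iA xW ib' iu'.
have m' : mu c (res c A x b') (W :\ x).
  by apply: smu_split => // w wW _; rewrite ox cards1 (deg_gt1 sm.1).
have cW := cardsD1 x W; rewrite xW in cW.
have [||w] := IH _ m'; first by lia.
  by have := card_occs_res c A x b'; rewrite ox cards1; lia.
rewrite !inE => /andP[wx wW] dw; have := d9 wW; rewrite (deg_res c A x b') ox.
suff -> : [set k in [set i] | c k w != None] = set0 by rewrite cards0; lia.
by apply/setP => k; rewrite !inE; case: eqP => [->|] //=; rewrite iu'.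
Qed.

(** Degree 4 after the split against at least 9 before puts the variable into all 5 removed
    clauses. *)
Lemma six_full v b : minvar c A W v -> #|occs c A v b| = 5 ->
  [/\ forall w, w \in W :\ v -> deg c (res c A v b) w = 4,
      forall w, w \in W -> deg c A w = 9 &
      forall i w, i \in occs c A v b -> w \in W -> c i w != None].
Proof.
move=> mv e5; have [dv _] := six_type mv; have vW := mv.1.
have [_ _ r] := minvar_occs b sm mv cA; rewrite e5 in r.
have ge4 w : w \in W :\ v -> 4 <= deg c (res c A v b) w.
  rewrite !inE => /andP[_ wW]; have := d9 wW; have := deg_res_le c A v b w; lia.
have eq4 := mu2_deg_eq4 (minvar_split b sm mv) r ge4 (six_no_unit mv e5).
have sub w : [set k in occs c A v b | c k w != None] \subset occs c A v b.
  by apply/subsetP => k; rewrite inE => /andP[].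
have full w : w \in W :\ v -> [set k in occs c A v b | c k w != None] == occs c A v b.
  move=> wW'; rewrite eqEcard sub e5; have wW : w \in W by move: wW'; rewrite !inE => /andP[].
  by have := d9 wW; rewrite (deg_res c A v b) eq4 //; lia.
split=> // [w wW|i w io wW].
  have [->//|wv] := eqVneq w v; have wW' : w \in W :\ v by rewrite !inE wv.
  by rewrite (deg_res c A v b) (eqP (full w wW')) e5 eq4.
have [->|wv] := eqVneq w v; first by move: io; rewrite inE => /andP[_ /eqP ->].
have /full/eqP/setP/(_ i) : w \in W :\ v by rewrite !inE wv.
by rewrite inE io.
Qed.

(* [B w] is the sign occurring 5 times at [w]; those clauses contain all variables, so after [v := b] the
   remaining non-full clauses only contain literals [(w, ~~ B w)]. The assignment [~~ B] and its
   one-variable changes then falsify pairwise distinct full clauses. *)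
Lemma six_absurd : False.
Proof.
have W0 : W != set0 by rewrite -card_gt0 (ltn_trans _ W1).
have [v mv] : exists v, minvar c A W v.
  have /set0Pn[w0 w0W] := W0.
  by case: (arg_minnP (deg c A) w0W) => y yW le; exists y; split.
have vW := mv.1.
have [_ [b e5 _]] := six_type mv.
have [eq4 all9 fullv] := six_full mv e5.
have mvw w : w \in W -> minvar c A W w by move=> wW; split=> // u uW; rewrite !all9.
pose B w := #|occs c A w true| == 5.
have fullB i w u : i \in A -> w \in W -> c i w = Some (B w) -> u \in W -> c i u != None.
  move=> iA wW iw uW.
  have eB : #|occs c A w (B w)| = 5.
    have [_ [b' e' e'']] := six_type (mvw w wW).
    rewrite /B; case: b' e' e'' => /= e' e''; first by rewrite e' eqxx.
    by rewrite e''; exact: e'.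
  have [_ _ h] := six_full (mvw w wW) eB.
  by apply: h => //; rewrite inE iA iw eqxx.
pose G := res c A v b; pose W' := W :\ v.
have mG : mu c G W' := minvar_split b sm mv.
have [usG crG _] := mG.
have nu : ~ unit_in c G W' := six_no_unit mv e5.
have [_ _ cG] := minvar_occs b sm mv cA; rewrite e5 -/G -/W' in cG.
have GA i : i \in G -> i \in A by rewrite inE => /andP[].
have W'W w : w \in W' -> w \in W by rewrite inE => /andP[].
have nempty i : i \in G -> (forall w, w \in W' -> c i w = None) -> False.
  by move=> iG h; move: cG; rewrite (mu_empty mG iG h) cards1; lia.
have opt (o : option bool) x : o != None -> o <> Some (~~ x) -> o = Some x.
  by case: o => [[]|] //; case: x.
pose phi0 : {ffun V -> bool} := [ffun w => ~~ B w].
have [M MG Mn] := unsatP phi0 usG.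
have MB w : w \in W' -> c M w = Some (B w).
  have [u uW' Mu] : exists2 u, u \in W' & c M u != None.
    have [/exists_inP//|] := boolP [exists u in W', c M u != None].
    rewrite negb_exists => /forallP h; case: (nempty M MG) => x xW'.
    by move: (h x); rewrite xW' /= negbK => /eqP.
  have MuB : c M u = Some (B u).
    by apply: opt => //; have := Mn u uW'; rewrite ffunE.
  move=> wW'; apply: opt; last by have := Mn w wW'; rewrite ffunE.
  by apply: (fullB M u) => //; [exact: GA|exact: W'W|exact: W'W].
have [n nP] : exists n : V -> T, forall u, u \in W' ->
    [/\ n u \in G, c (n u) u = Some (~~ B u) &
        forall w, w \in W' -> w != u -> c (n u) w = Some (B w)].
  apply: (@fin_all_exists V (fun _ => T) (fun u i => u \in W' ->
    [/\ i \in G, c i u = Some (~~ B u) &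
        forall w, w \in W' -> w != u -> c i w = Some (B w)])) => u.
  have [uW'|_] := boolP (u \in W'); last by exists M.
  have [i iG nn] := unsatP (upd phi0 u (B u)) usG.
  have iB w : w \in W' -> w != u -> c i w != None -> c i w = Some (B w).
    by move=> wW' wu iw; apply: opt => //; have := nn w wW'; rewrite !ffunE (negbTE wu).
  have [x xW' [xu ix]] : exists2 x, x \in W' & x != u /\ c i x != None.
    have [/exists_inP[x xW' /andP[xu ix]]|] := boolP [exists x in W', (x != u) && (c i x != None)].
      by exists x.
    rewrite negb_exists => /forallP h; case: nu; exists i, u; split=> // w wW' wu.
    by move: (h w); rewrite wW' wu /= negbK => /eqP.
  have full w : w \in W' -> c i w != None.
    by move=> wW'; apply: (fullB i x); [exact: GA|exact: W'W|exact: iB|exact: W'W].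
  exists i => _; split=> // [|w wW' wu]; last by apply: iB => //; exact: full.
  apply: opt; first exact: full.
  by have := nn u uW'; rewrite ffunE eqxx negbK.
have ninj : {in W' &, injective n}.
  move=> u u' uW' u'W' e; apply/eqP/negPn/negP => uu'.
  have [_ nu1 _] := nP u uW'; have [_ _ /(_ u uW' uu')] := nP u' u'W'.
  by rewrite -e nu1; case: (B u).
pose D := M |: [set n u | u in W'].
have cD : #|D| = #|W'|.+1.
  rewrite cardsU1 card_in_imset // (_ : M \notin _) //.
  apply/imsetP => -[u uW' e]; have [_ + _] := nP u uW'.
  by rewrite -e MB //; case: (B u).
have Dsub w : w \in W' -> D \subset [set i in G | c i w != None].
  move=> wW'; apply/subsetP => i; rewrite in_setU1 => /orP[/eqP->|/imsetP[u uW' ->]].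
    by rewrite inE MG MB.
  have [nG n1 n2] := nP u uW'; rewrite inE nG /=.
  by have [->|wu] := eqVneq w u; [rewrite n1 | rewrite n2].
have [w0 w0W'] : exists w, w \in W' by apply/set0Pn; exact: setD1_neq0.
(* All [#|W'| + 1] clauses of [D] contain [w0], which has degree 4 in [G]. *)
have le4 : #|W'| <= 3.
  by have := subset_leq_card (Dsub w0 w0W'); rewrite cD -/(deg c G w0) eq4.
(* Five distinct full clauses share the literal at [v], so [2 ^ #|W'|] is at least 5. *)
have ge3 : 3 <= #|W'|.
  rewrite -(@ltn_exp2l 2) //.
  have : #|occs c A v b| <= #|powerset W'|.
    pose t i := [set w in W' | c i w == Some true].
    rewrite -(card_in_imset (f := t)).
      apply: subset_leq_card; apply/subsetP => s /imsetP[i _ ->].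
      by rewrite powersetE; apply/subsetP => w; rewrite inE => /andP[].
    move=> i j io jo e; have iA : i \in A by move: io; rewrite inE => /andP[].
    have jA : j \in A by move: jo; rewrite inE => /andP[].
    apply: (mu_rows_inj sm.1 iA jA) => w wW.
    have [->|wv] := eqVneq w v.
      by move: io jo; rewrite !inE => /andP[_ /eqP->] /andP[_ /eqP->].
    have := fullv i w io wW; have := fullv j w jo wW.
    move/setP/(_ w): e; rewrite !inE wv wW /=.
    by case: (c i w) (c j w) => [[]|] [[]|].
  rewrite e5 card_powerset; lia.
(* [D] has 4 clauses and so exhausts the occurrences of every variable in [G]; the fifth clause of
   [G] would be empty. *)
have [j jG jD] : exists2 j, j \in G & j \notin D.
  have : 0 < #|G :\: D|.
    by have := cardsID D G; have := subset_leq_card (subsetIr G D); lia.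
  by move=> /card_gt0P[j]; rewrite inE => /andP[jD jG]; exists j.
apply: (nempty j jG) => w wW'; apply/eqP/negPn/negP => jw.
have /eqP/setP/(_ j) : D == [set i in G | c i w != None].
  by rewrite eqEcard Dsub // cD -/(deg c G w) eq4 //; lia.
by rewrite (negbTE jD) in_set jG jw.
Qed.

End Deficiency6.

Lemma mu6_deg_le8 c A W : mu c A W -> #|A| = #|W| + 6 -> exists2 w, w \in W & deg c A w <= 8.
Proof.
have [n] := ubnP #|W|; elim: n c A W => // n IH c A W lt m cA.
have [/exists_inP[w wW dw]|] := boolP [exists w in W, deg c A w <= 8]; first by exists w.
rewrite negb_exists => /forallP no; exfalso.
have [c' s sm] := saturate m.
apply: (six_absurd sm cA) => [w wW|A' W' lt']; last by apply: IH; lia.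
by apply: leq_trans (subc_deg A w s); move: (no w); rewrite wW /= -ltnNge.
Qed.

(** * The recursion *)

Definition mindeg_le k m := forall c A W, mu c A W -> #|A| = #|W| + k -> W != set0 ->
  exists2 w, w \in W & deg c A w <= m.

Lemma leq_foldr_maxn s x : x \in s -> x <= foldr maxn 0 s.
Proof.
elim: s => //= y s IH; rewrite inE => /orP[/eqP->|/IH le]; first exact: leq_maxl.
exact: leq_trans le (leq_maxr _ _).
Qed.

Lemma foldr_minn_leq s a x : x \in s -> foldr minn a s <= x.
Proof.
elim: s => //= y s IH; rewrite inE => /orP[/eqP->|/IH le]; first exact: geq_minl.
exact: leq_trans (geq_minr _ _) le.
Qed.

Lemma leq_largest_m g k m : 4 <= m <= 2 * k -> pdp_nonempty g k m -> m <= largest_m g k.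
Proof.
by move=> mk p; apply: leq_foldr_maxn; rewrite mem_filter p mem_iota; lia.
Qed.

Lemma pdp_nonemptyI g k e0 e1 : 2 <= e0 <= k -> 2 <= e1 <= k -> e0 <= e1 ->
  cond_v g k e0 (e0 + e1) -> cond_v g k e1 (e0 + e1) -> pdp_nonempty g k (e0 + e1).
Proof.
move=> /andP[a b] /andP[a' b'] le c0 c1; apply/hasP; exists e0.
  by rewrite mem_iota; lia.
by rewrite /= addKn a a' b b' eqxx le c0 c1.
Qed.

(** If a sign occurs once, the degree is at most [k + 1]. Otherwise the two numbers of occurrences,
    in increasing order, witness [pdp_nonempty] at the minimum degree: condition (v) holds because
    the split has a variable of degree at most [g (k - e + 1)], with at most [e] further occurrences
    before. *)
Lemma mindeg_le_largest_m g k : 1 < k ->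
  (forall j y, 0 < j < k -> g j = Some y -> mindeg_le j y) ->
  k < largest_m g k -> mindeg_le k (largest_m g k).
Proof.
move=> k1 IH kl c A W m cA W0.
have W1 := mu_vars_gt1 m cA k1.
have [c' [v [s sm mv]]] := saturate_minvar m W0.
exists v; first exact: mv.1.
apply: leq_trans (subc_deg A v s) _.
have e_gt0 b : 0 < #|occs c' A v b| by have [] := minvar_occs b sm mv cA.
have e_le b : #|occs c' A v b| <= k by have [] := minvar_occs b sm mv cA.
have [b /eqP e1|ge2] := pickP (fun b => #|occs c' A v b| == 1).
  by rewrite (degEb c' A v b) e1; have := e_le (~~ b); lia.
have {}ge2 b : 1 < #|occs c' A v b| by have := ge2 b; have := e_gt0 b; lia.
have cond b : cond_v g k #|occs c' A v b| (deg c' A v).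
  rewrite /cond_v; case gj: (g _) => [y|] //=.
  have [_ _ r] := minvar_occs b sm mv cA.
  have jk : 0 < k - #|occs c' A v b| + 1 < k by have := ge2 b; have := e_le b; lia.
  have [w] := IH _ _ jk gj _ _ _ (minvar_split b sm mv) r (setD1_neq0 mv.1 W1).
  rewrite !inE => /andP[_ wW] dw; apply: leq_trans (mv.2 w wW) _.
  by apply: leq_trans (deg_res_le c' A v b w) _; rewrite leq_add2r.
have [b le] : exists b, #|occs c' A v b| <= #|occs c' A v (~~ b)|.
  by case: (leqP #|occs c' A v true| #|occs c' A v false|) => [le|/ltnW le];
    [exists true|exists false].
have := cond b; have := cond (~~ b); rewrite (degEb c' A v b) => c1 c0.
apply: leq_largest_m.
  by have := ge2 b; have := e_le b; have := ge2 (~~ b); have := e_le (~~ b); lia.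
by apply: pdp_nonemptyI; rewrite ?ge2 ?e_le.
Qed.

Lemma size_nM_vals f n : size (nM_vals f n) = n.+1.
Proof. by elim: n => //= n IH; rewrite size_rcons IH. Qed.

Lemma nM_S f n : nM f n.+1 = nM_step f (fun j => nth None (nM_vals f n) j) n.+1.
Proof. by rewrite /nM /= nth_rcons size_nM_vals ltnn eqxx. Qed.

Lemma nth_nM_vals f n j : j <= n -> nth None (nM_vals f n) j = nM f j.
Proof.
elim: n => [|n IH]; first by case: j.
rewrite leq_eqVlt => /orP[/eqP->//|le].
by rewrite /= nth_rcons size_nM_vals le IH.
Qed.

(** The bound [k < y] keeps the induction running: it makes the pair (2, k) admissible for [k + 2],
    so that [largest_m] exceeds [k]. *)
Lemma N1_mindeg k : 0 < k -> exists y, [/\ N1 k = Some y, k < y & mindeg_le k y].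
Proof.
elim/ltn_ind: k => -[//|[|n]] IH _.
  by exists 2; split=> // c A W; exact: mu1_deg_le2.
set k := n.+2 in IH *; pose g j := nth None (nM_vals f_246588 n.+1) j.
have gN j : j < k -> g j = N1 j by move=> jk; rewrite /g nth_nM_vals.
have N1k : N1 k = ext_min (Some (largest_m g k)) (f_246588 k) by rewrite /N1 nM_S.
have lk : k < largest_m g k.
  have [y [gy ky _]] := IH n.+1 (ltnSn _) isT.
  have : 2 + k <= largest_m g k; last by lia.
  apply: leq_largest_m; first by rewrite /k; lia.
  apply: pdp_nonemptyI; rewrite ?leqnn ?andbT //.
    have e : k - 2 + 1 = n.+1 by rewrite /k; lia.
    by rewrite /cond_v e gN // gy /=; lia.
  by rewrite /cond_v subnn add0n gN // (_ : N1 1 = Some 2) //= leqnn.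
have bk : mindeg_le k (largest_m g k).
  apply: mindeg_le_largest_m => // j y /andP[j0 jk]; rewrite gN // => e.
  by have [y' [e' _]] := IH j jk j0; move: e; rewrite e' => -[->].
(* For [k] from 2 to 5 the recursion already gives the prescribed values, and from 7 on none is
   prescribed. At 6 it gives 9, and the value 8 comes from [mu6_deg_le8]. *)
rewrite N1k; case: n @k {IH gN N1k} @g lk bk => [|[|[|[|[|n]]]]] k g lk bk; last first.
  by exists (largest_m g k); split.
  by exists 8; split; [vm_compute| |move=> c A W m cA _; exact: mu6_deg_le8].
all: by exists (largest_m g k); split; [vm_compute|exact: lk|exact: bk].
Qed.

End Incidence.

(** * The incidence matrix of a clause-set *)

(** The order of the tests matters only for sets containing both signs, which are not clauses. *)
Definition incidence (F : clauseset) (i : F) (w : var F) : option bool :=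
  if (val w, true) \in val i then Some true
  else if (val w, false) \in val i then Some false else None.

Lemma incidence_lit (F : clauseset) (i : F) (w : var F) b : incidence i w = Some b -> (val w, b) \in val i.
Proof. by rewrite /incidence; case: ifP => [h [<-]//|_]; case: ifP => // h [<-]. Qed.

Lemma lit_incidence (F : clauseset) (i : F) (w : var F) b : is_clauseset F -> (val w, b) \in val i ->
  incidence i w = Some b.
Proof.
move=> cl wi; rewrite /incidence; case: b wi => wi; first by rewrite wi.
by rewrite wi ifN //; have := cl _ (valP i) _ wi.
Qed.

Lemma mem_var (F : clauseset) (C : clause) x : C \in F -> x \in C -> x.1 \in var F.
Proof.
by move=> CF xC; apply/bigfcupP; exists C; rewrite ?CF //; apply: in_imfset.
Qed.

Lemma mu_incidence F : is_clauseset F -> MU F -> mu (@incidence F) setT setT.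
Proof.
move=> cl [us cr]; split.
- apply/negP => /existsP[phi /forallP h]; apply: us.
  (* No clause mentions a name outside [var F]; such names get the default value [true]. *)
  exists (fun n => if insub n : option (var F) is Some w then phi w else true) => C CF.
  have := h [` CF]; rewrite inE => /satcP[w _ /incidence_lit wC].
  by exists (val w, phi w) => //=; rewrite valK.
- move=> i _; have [phi h] := cr _ (valP i).
  exists [ffun w => phi (val w)] => j _ ji.
  have [|x xj px] := h (val j); first by rewrite !inE (valP j) andbT.
  have xF := mem_var (valP j) xj.
  apply/satcP; exists [` xF] => //; apply: lit_incidence => //.
  by rewrite ffunE /= px -surjective_pairing.
- move=> w _; have /bigfcupP[C /andP[CF _] /imfsetP[x xC wx]] := valP w.
  exists [` CF] => //; rewrite (@lit_incidence _ _ _ x.2) //.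
  by rewrite /= wx -surjective_pairing.
Qed.

Lemma vdeg_le_deg F (w : var F) : (vdeg F (val w) <= deg (@incidence F) setT w)%N.
Proof.
rewrite /vdeg enum_fsetE count_map /deg cardE size_filter -enumT.
by apply: sub_count => i /=; rewrite !inE /incidence; case: ifP => //= _ ->.
Qed.

(* minvdeg(MU_{delta=k}) <= N1(k): every F in MU with delta(F) = k and var(F) <> ∅
   has minvdeg(F) <= N1(k). *)
Theorem theorem14p6 (k : nat) : (1 <= k)%N ->
  forall F : clauseset, is_clauseset F -> MU F -> delta F = (k%:Z)%R ->
  var F != fset0 -> ext_leq (minvdeg F) (N1 k).
Proof.
move=> k1 F cl mF dF vF.
have [y [-> _ bnd]] := @N1_mindeg F (var F) k k1.
have cF : #|[set: F]| = (#|[set: var F]| + k)%N.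
  by move: dF; rewrite /delta !cardsT -!cardfE; lia.
have vT : [set: var F] != set0.
  by have /fset0Pn[n nF] := vF; apply/set0Pn; exists [` nF]; rewrite inE.
have [w _ dw] := bnd _ _ _ (mu_incidence cl mF) cF vT.
apply: leq_trans dw; apply: leq_trans (vdeg_le_deg w).
by apply: foldr_minn_leq; apply: map_f; exact: valP.
Qed.
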